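(* Let $f\colon\{-1,1\}^n\to\{-1,1\}$ be a Boolean function and let $\mathscr{C}=\{C_1,\dots,C_t\}$ be a partition of $\{-1,1\}^n$ into affine subspaces on each of which $f$ is constant, such that, for some $1\le t_1<t$, $\{C_1,\dots,C_{t_1}\}$ is a partition of $f^{-1}(-1)$ and $\{C_{t_1+1},\dots,C_t\}$ is a partition of $f^{-1}(1)$. Let $p=\Pr_x[f(x)=1]$ for $x$ uniform in $\{-1,1\}^n$. Then both of the following hold: $$\mathbb{H}(\hat f^2)\le 2\left(\sum_{i=1}^{t_1}\mathrm{codim}(C_i)\cdot2^{-\mathrm{codim}(C_i)}+p\cdot\max_{1\le i\le t_1}\mathrm{codim}(C_i)\right),$$ $$\mathbb{H}(\hat f^2)\le 2\left(\sum_{i=t_1+1}^{t}\mathrm{codim}(C_i)\cdot2^{-\mathrm{codim}(C_i)}+(1-p)\cdot\max_{t_1+1\le i\le t}\mathrm{codim}(C_i)\right).$$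
   Context: All logarithms are base 2. For $g\colon\{-1,1\}^n\to\mathbb{R}$ and $S\subseteq[n]$, $\hat g(S)=\mathbb{E}_x[g(x)\prod_{i\in S}x_i]$ with $x$ uniform in $\{-1,1\}^n$. For Boolean $f\colon\{-1,1\}^n\to\{-1,1\}$ we have $\sum_S\hat f(S)^2=1$, and the Fourier entropy is $\mathbb{H}(\hat f^2)=\sum_{S\subseteq[n]}\hat f(S)^2\log\frac{1}{\hat f(S)^2}$ (with $0\log\frac10=0$). Identify $\{-1,1\}^n$ with $\mathbb{F}_2^n$ via $-1\leftrightarrow 1$, $1\leftrightarrow 0$ coordinatewise. An affine subspace of $\{-1,1\}^n$ of co-dimension $k$ is then a (nonempty) set of the form $\{x:\prod_{i\in S_j}x_i=b_j,\ j=1,\dots,k\}$ with $b_j\in\{-1,1\}$ and $S_1,\dots,S_k\subseteq[n]$ whose indicator vectors are linearly independent over $\mathbb{F}_2$; its co-dimension is denoted $\mathrm{codim}$. *)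

(* Defs.v *)
From HB Require Import structures.
From mathcomp Require Import all_boot all_order all_algebra.
From mathcomp Require Import reals exp.

Set Implicit Arguments.
Unset Strict Implicit.
Unset Printing Implicit Defensive.

Import Order.TTheory GRing.Theory Num.Theory.
Local Open Scope ring_scope.

(* A point of {-1,1}^n is stored through the identification with F_2^n:
   the bit b stands for the sign (-1)^b, so true is -1 and false is 1. *)
Notation cube n := {ffun 'I_n -> bool}.

Definition spin (R : pzRingType) (b : bool) : R := (-1) ^+ b.

Definition chi (R : comPzRingType) (n : nat) (S : {set 'I_n}) (x : cube n) : R :=
  \prod_(i in S) spin R (x i).

Definition expectation (R : realType) (n : nat) (g : cube n -> R) : R :=
  (\sum_x g x) / #|{: cube n}|%:R.

Definition prob (R : realType) (n : nat) (P : pred (cube n)) : R :=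
  #|[set x | P x]|%:R / #|{: cube n}|%:R.

Definition fourier (R : realType) (n : nat) (g : cube n -> R) (S : {set 'I_n}) : R :=
  expectation (fun x => g x * chi R S x).

Definition log2 (R : realType) (a : R) : R := ln a / ln 2.

(* A summand with a zero coefficient is 0 * log2 (0^-1) = 0, which is the
   convention 0 log (1/0) = 0. *)
Definition fourier_entropy (R : realType) (n : nat) (g : cube n -> R) : R :=
  \sum_(S : {set 'I_n}) fourier g S ^+ 2 * log2 (1 / fourier g S ^+ 2).

Definition indicator_mx (n k : nat) (S : 'I_k -> {set 'I_n}) : 'M['F_2]_(k, n) :=
  \matrix_(j, i) (i \in S j)%:R.

(* Row-freeness makes the parity system solvable, so such a set is nonempty; it
   has 2^(n-k) points, so k is determined by C. *)
Definition affine_subspace_of_codim (n : nat) (C : {set cube n}) (k : nat) : Prop :=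
  exists (S : 'I_k -> {set 'I_n}) (b : 'I_k -> bool),
    row_free (indicator_mx S) /\
    C = [set x | [forall j, chi int (S j) x == spin int (b j)]].

(* Main.v *)
(* The level set of f on one side is split into the given affine cells, and the
   other side is kept as one cell. The functions f * 1_cell have orthogonal
   Fourier transforms, and the one of a cell of codimension k takes values in
   2^-k Z. Whenever a unit vector F is a sum of orthogonal vectors c_i of squared
   norm w_i with entries in 2^-k_i Z, the entropy of F^2 is at most
   2 * \sum_i w_i k_i: comparing F with its truncations gives this bound up to an
   additive constant, which disappears under tensor powers. *)
Require Import Defs.
From HB Require Import structures.
From mathcomp Require Import all_boot all_order all_algebra.
From mathcomp Require Import reals exp.
From mathcomp Require Import ring lra.

Set Implicit Arguments.
Unset Strict Implicit.
Unset Printing Implicit Defensive.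

Import Order.TTheory GRing.Theory Num.Theory.
Local Open Scope ring_scope.

(** * Base-2 logarithms and the dyadic scale of a number *)

Lemma log2M (R : realType) (a b : R) :
  0 < a -> 0 < b -> log2 (a * b) = log2 a + log2 b.
Proof. by move=> a0 b0; rewrite /log2 lnM ?posrE// mulrDl. Qed.

Lemma log2_exp2 (R : realType) (d : nat) : log2 (2 ^+ d : R) = d%:R.
Proof.
have ln2 : ln (2 : R) != 0 by rewrite gt_eqF// ln_gt0// ltr1n.
by rewrite /log2 lnXn// -[ln 2 *+ d]mulr_natl mulfK.
Qed.

Lemma log2_le (R : realType) (a b : R) : 0 < a -> a <= b -> log2 a <= log2 b.
Proof.
move=> a0 ab; rewrite /log2 ler_pM2r ?invr_gt0 ?ln_gt0 ?ltr1n//.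
by rewrite ler_ln ?posrE// (lt_le_trans a0).
Qed.

(** For nonzero [a], take the least [d] with |a| > 2^-(d+1); minimality gives |a| <= 2^-d. Rounding
    the logarithm up to an integer is the source of the later additive constant. *)
Lemma dyadic_scale (R : realType) (a : R) : `|a| <= 1 ->
  exists d, `|a| * 2 ^+ d <= 1 /\
    a ^+ 2 * log2 (1 / a ^+ 2) <= a ^+ 2 * (2 * d.+1%:R).
Proof.
move=> a1; have [->|a0] := eqVneq a 0.
  by exists 0; rewrite normr0 expr0n/= !mul0r ler01.
have na : 0 < `|a| by rewrite normr_gt0.
have ex : exists d, 1 < `|a| * 2 ^+ d.+1.
  exists (Num.bound `|a|^-1); rewrite mulrC -ltr_pdivrMr// mul1r.
  exact: upper_nthrootP.
case: (ex_minnP ex) => d hd min; exists d; split.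
  by case: d {hd} min => [|d] min; rewrite ?mulr1// leNgt; apply/negP => /min;
     rewrite ltnn.
apply: ler_wpM2l; first exact: sqr_ge0.
have -> : 2 * d.+1%:R = (d.+1 * 2)%:R :> R by rewrite natrM mulrC.
rewrite -log2_exp2; apply: log2_le; first by rewrite divr_gt0// exprn_even_gt0.
rewrite exprM ler_pdivrMr ?exprn_even_gt0// -[a ^+ 2]real_normK ?num_real// -exprMn.
by rewrite exprn_ege1// mulrC ltW.
Qed.

(** * Entropy of a sum of orthogonal granular vectors *)

Definition sq_entropy (R : realType) (X : finType) (F : X -> R) : R :=
  \sum_s F s ^+ 2 * log2 (1 / F s ^+ 2).

(** Given orthogonality, [\sum_i w i = 1] is the normalisation of [F] to a unit vector. *)
Definition granular_decomposition (R : realType) (X I : finType)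
    (F : X -> R) (c : I -> X -> R) (w : I -> R) (k : I -> nat) : Prop :=
  [/\ forall s, F s = \sum_i c i s,
      forall i j, \sum_s c i s * c j s = if i == j then w i else 0,
      \sum_i w i = 1
    & forall i s, c i s * 2 ^+ k i \is a Num.int].

(** A nonzero integer has |m| >= 1, hence |b - m| >= 1 - |b| >= 1/2 >= |b|. *)
Lemma dist_int_ge (R : realType) (b m : R) :
  `|b| <= 2^-1 -> m \is a Num.int -> b ^+ 2 <= (b - m) ^+ 2.
Proof.
move=> hb mi; have [->|m0] := eqVneq m 0; first by rewrite subr0.
have m1 := norm_intr_ge1 mi m0.
rewrite -[b ^+ 2]real_normK ?num_real// -[X in _ <= X]real_normK ?num_real//.
rewrite ler_sqr ?nnegrE//.
have := ler_normB b (b - m); rewrite opprB addrC subrK; lra.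
Qed.

Lemma norm_sq_partial (R : realType) (X I : finType) (F : X -> R)
    (c : I -> X -> R) (w : I -> R) (k : I -> nat) (P : pred I) :
  granular_decomposition F c w k ->
  \sum_s (\sum_(i | P i) c i s) ^+ 2 = \sum_(i | P i) w i.
Proof.
move=> [_ ortho _ _].
under eq_bigr do rewrite expr2 big_distrlr/=.
rewrite exchange_big/=; apply: eq_bigr => i Pi.
rewrite exchange_big/= (bigD1 i)//= ortho eqxx big1 ?addr0// => j /andP[_ ji].
by rewrite ortho eq_sym (negPf ji).
Qed.

Lemma granular_norm_sq (R : realType) (X I : finType) (F : X -> R)
    (c : I -> X -> R) (w : I -> R) (k : I -> nat) :
  granular_decomposition F c w k -> \sum_s F s ^+ 2 = 1.
Proof.
move=> H; have [FE _ w1 _] := H; rewrite -w1 -(norm_sq_partial predT H).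
by apply: eq_bigr => s _; rewrite FE.
Qed.

Lemma sum_ord_lt (R : realType) (K d : nat) (x : R) :
  \sum_(j < K | (j < d)%N) x = (minn K d)%:R * x.
Proof.
elim: K => [|K IH]; first by rewrite big_ord0 min0n mul0r.
rewrite big_mkcond big_ord_recr/= -big_mkcond/= IH.
case: ltnP => dK.
  by rewrite (minn_idPl dK) -[K.+1]addn1 natrD mulrDl mul1r.
by rewrite addr0 (minn_idPr (leqW dK)).
Qed.

(* Compare F with its truncations \sum_(k i <= j) c i, which take values in
   2^-j Z: when |F s| <= 2^-d, each truncation with j < d is at distance at
   least |F s| from F s. *)
Lemma entropy_le_slack (R : realType) (X I : finType) (F : X -> R)
    (c : I -> X -> R) (w : I -> R) (k : I -> nat) :
  granular_decomposition F c w k ->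
  sq_entropy F <= 2 * \sum_i w i * (k i)%:R + 2.
Proof.
move=> H; have [FE ortho w1 gran] := H; have F1 := granular_norm_sq H.
have w0 i : 0 <= w i.
  by move: (ortho i i); rewrite eqxx => <-; apply: sumr_ge0 => s _; rewrite -expr2 sqr_ge0.
have Fle1 s : `|F s| <= 1.
  rewrite -ler_sqr ?nnegrE// real_normK ?num_real// expr1n -F1 (bigD1 s)//=.
  by rewrite lerDl sumr_ge0// => u _; exact: sqr_ge0.
have /fin_all_exists[d hd] s := dyadic_scale (Fle1 s).
pose K := \max_s d s.
have dK s : (d s <= K)%N by exact: leq_bigmax.
have main : \sum_s F s ^+ 2 * (d s)%:R <= \sum_i w i * (k i)%:R.
  (* Layer-cake summation: [d s] is the number of levels [j < d s], and [K] bounds all levels. *)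
  have -> : \sum_s F s ^+ 2 * (d s)%:R =
            \sum_(j < K) \sum_(s | (j < d s)%N) F s ^+ 2.
    rewrite (exchange_big_dep predT)//=; apply: eq_bigr => s _.
    by rewrite sum_ord_lt (minn_idPr (dK s)) mulrC.
  (* Level [j] is charged to the pieces with [j < k i], so piece [i] is charged at most [k i]
     times. *)
  apply: (@le_trans _ _ (\sum_(j < K) \sum_(i | (j < k i)%N) w i)); last first.
    rewrite (exchange_big_dep predT)//=; apply: ler_sum => i _.
    by rewrite sum_ord_lt mulrC ler_wpM2l// ler_nat geq_minr.
  (* By Pythagoras the charge at level [j] is the squared norm of [F] minus its truncation. *)
  apply: ler_sum => j _; rewrite -(norm_sq_partial _ H).
  rewrite [leRHS](bigID (fun s => (j < d s)%N))/= ler_wpDr ?sumr_ge0//.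
    by move=> s _; exact: sqr_ge0.
  apply: ler_sum => s jd.
  have -> : \sum_(i | (j < k i)%N) c i s = F s - \sum_(i | (k i <= j)%N) c i s.
    rewrite FE [X in _ = X - _](bigID (fun i => (j < k i)%N))/=.
    rewrite [X in _ = _ + X - _](eq_bigl (fun i => (k i <= j)%N)) ?addrK//.
    by move=> i; rewrite /= -leqNgt.
  (* After scaling by 2^j the truncation is an integer, and [j < d s] makes the scaled [F s] at most
     1/2 in absolute value. *)
  have p0 : 0 < (2 : R) ^+ j by rewrite exprn_gt0.
  rewrite -(ler_pM2r (exprn_gt0 2 p0)) -!exprMn mulrBl; apply: dist_int_ge.
    rewrite normrM (gtr0_norm p0) -[leRHS]mul1r ler_pdivlMr// -mulrA -exprSr.
    apply: le_trans (hd s).1; rewrite ler_wpM2l// ler_eXn2l ?ltr1n//.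
  rewrite mulr_suml rpred_sum// => i kij.
  by rewrite -(subnKC kij) exprD mulrA rpredM// rpredX// rpred_nat.
apply: (@le_trans _ _ (\sum_s F s ^+ 2 * (2 * (d s).+1%:R))).
  by apply: ler_sum => s _; exact: (hd s).2.
(* The slack 2 is the total cost of having [d s + 1] instead of [d s]. *)
have -> : \sum_s F s ^+ 2 * (2 * (d s).+1%:R) =
          2 * (\sum_s F s ^+ 2 * (d s)%:R) + 2.
  transitivity (\sum_s (2 * (F s ^+ 2 * (d s)%:R) + 2 * F s ^+ 2)).
    by apply: eq_bigr => s _; rewrite -natr1; ring.
  by rewrite big_split/= -!mulr_sumr F1 mulr1.
by rewrite lerD2r ler_pM2l.
Qed.

(** Entropy is additive over product distributions: the logarithm splits, and the factor left over
    in each half sums to 1. *)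
Lemma sq_entropy_tensor (R : realType) (X : finType) (F : X -> R) :
  \sum_s F s ^+ 2 = 1 ->
  sq_entropy (fun s : X * X => F s.1 * F s.2) = 2 * sq_entropy F.
Proof.
move=> F1.
transitivity (\sum_s \sum_u (F s ^+ 2 * log2 (1 / F s ^+ 2) * F u ^+ 2 +
                             F s ^+ 2 * (F u ^+ 2 * log2 (1 / F u ^+ 2)))).
  rewrite pair_bigA/=; apply: eq_bigr => -[s u] _ /=; rewrite exprMn.
  have [->|s0] := eqVneq (F s) 0; first by rewrite expr0n/= !mul0r addr0.
  have [->|u0] := eqVneq (F u) 0; first by rewrite expr0n/= !(mul0r, mulr0) addr0.
  rewrite !mul1r invfM log2M ?invr_gt0 ?exprn_even_gt0//; ring.
under eq_bigr do rewrite big_split/= -!mulr_sumr F1 mulr1.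
by rewrite big_split/= -mulr_suml F1 mul1r mulrDl mul1r.
Qed.

(** Inner products of tensors factor, and denominators multiply, so the exponents add. *)
Lemma granular_decomposition_tensor (R : realType) (X I : finType) (F : X -> R)
    (c : I -> X -> R) (w : I -> R) (k : I -> nat) :
  granular_decomposition F c w k ->
  granular_decomposition (fun s : X * X => F s.1 * F s.2)
    (fun (i : I * I) s => c i.1 s.1 * c i.2 s.2)
    (fun i => w i.1 * w i.2) (fun i => (k i.1 + k i.2)%N).
Proof.
move=> [FE ortho w1 gran]; split.
- by move=> s; rewrite !FE big_distrlr/= pair_bigA.
- move=> [i i'] [j j'] /=.
  transitivity ((\sum_s c i s * c j s) * \sum_s c i' s * c j' s).
    by rewrite big_distrlr/= pair_bigA; apply: eq_bigr => s _; rewrite mulrACA.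
  by rewrite !ortho xpair_eqE; do 2 case: eqP; rewrite ?mul0r ?mulr0.
- by rewrite -[RHS]mulr1 -{1}w1 -[in RHS]w1 big_distrlr/= pair_bigA.
- by move=> [i j] [s u] /=; rewrite exprD mulrACA rpredM.
Qed.

(* Tensoring doubles both the entropy and \sum_i w i * k i, so the additive
   slack 2 can be divided by any power of two. *)
Lemma entropy_le_slack_exp2 (R : realType) (r : nat) (X I : finType)
    (F : X -> R) (c : I -> X -> R) (w : I -> R) (k : I -> nat) :
  granular_decomposition F c w k ->
  sq_entropy F <= 2 * \sum_i w i * (k i)%:R + 2 / 2 ^+ r.
Proof.
(* The types are generalised because the induction hypothesis is applied to the tensor square. *)
elim: r => [|r IH] in X I F c w k *; first by rewrite divr1; exact: entropy_le_slack.
move=> H; have [_ _ w1 _] := H.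
have := IH _ _ _ _ _ _ (granular_decomposition_tensor H).
rewrite (sq_entropy_tensor (granular_norm_sq H)).
have -> : \sum_(i : I * I) w i.1 * w i.2 * (k i.1 + k i.2)%:R =
          2 * \sum_i w i * (k i)%:R.
  transitivity (\sum_i \sum_j (w i * (k i)%:R * w j + w i * (w j * (k j)%:R))).
    by rewrite pair_bigA/=; apply: eq_bigr => i _; rewrite natrD; ring.
  under eq_bigr do rewrite big_split/= -!mulr_sumr w1 mulr1.
  by rewrite big_split/= -mulr_suml w1 mul1r mulrDl mul1r.
by rewrite exprSr invfM mulrA; lra.
Qed.

Lemma entropy_le (R : realType) (X I : finType) (F : X -> R)
    (c : I -> X -> R) (w : I -> R) (k : I -> nat) :
  granular_decomposition F c w k -> sq_entropy F <= 2 * \sum_i w i * (k i)%:R.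
Proof.
move=> H; apply/ler_addgt0Pr => e e0.
(* The exponent r is chosen so that 2 / 2^r < e. *)
apply: le_trans (entropy_le_slack_exp2 (Num.bound (2 / e)) H) _.
rewrite lerD2l ler_pdivrMr ?exprn_gt0// mulrC -ler_pdivrMr// ltW//.
exact: upper_nthrootP.
Qed.

(** * Characters, expectations and Plancherel on the cube *)

Lemma card_cube n : #|{: cube n}| = (2 ^ n)%N.
Proof. by rewrite card_ffun card_bool card_ord. Qed.

Lemma spin_addb (R : pzRingType) (a b : bool) :
  spin R (a (+) b) = spin R a * spin R b.
Proof. exact: signr_addb. Qed.

(** Reduces a character to a single bit, so that characters over [int] and over [R] can be
    compared. *)
Lemma chi_parity (R : comPzRingType) (n : nat) (S : {set 'I_n}) (x : cube n) :
  chi R S x = spin R (\big[addb/false]_(i in S) x i).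
Proof. by rewrite /chi (big_morph _ (@spin_addb R) (erefl : spin R false = 1)). Qed.

Lemma chi_exp (R : comPzRingType) (n : nat) (S : {set 'I_n}) (x : cube n) :
  chi R S x = \prod_i spin R (x i) ^+ (i \in S).
Proof. by rewrite /chi big_mkcond; apply: eq_bigr => i _; case: (i \in S). Qed.

Lemma eq_expectation (R : realType) (n : nat) (g h : cube n -> R) :
  g =1 h -> expectation g = expectation h.
Proof. by move=> gh; congr (_ / _); apply: eq_bigr => x _. Qed.

Lemma eq_fourier (R : realType) (n : nat) (g h : cube n -> R) T :
  g =1 h -> fourier g T = fourier h T.
Proof. by move=> gh; apply: eq_expectation => x; rewrite gh. Qed.

Lemma expectationZ (R : realType) (n : nat) (a : R) (g : cube n -> R) :
  expectation (fun x => a * g x) = a * expectation g.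
Proof. by rewrite /expectation -mulr_sumr mulrA. Qed.

Lemma expectation_sum (R : realType) (n : nat) (I : finType) (P : pred I)
    (g : I -> cube n -> R) :
  expectation (fun x => \sum_(i | P i) g i x) = \sum_(i | P i) expectation (g i).
Proof. by rewrite /expectation exchange_big/= mulr_suml. Qed.

Lemma fourierZ (R : realType) (n : nat) (a : R) (g : cube n -> R) T :
  fourier (fun x => a * g x) T = a * fourier g T.
Proof. by rewrite -expectationZ; apply: eq_expectation => x; rewrite mulrA. Qed.

Lemma fourier_sum (R : realType) (n : nat) (I : finType) (P : pred I)
    (g : I -> cube n -> R) T :
  fourier (fun x => \sum_(i | P i) g i x) T = \sum_(i | P i) fourier (g i) T.
Proof.
by rewrite -expectation_sum; apply: eq_expectation => x; rewrite mulr_suml.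
Qed.

Lemma fourierB (R : realType) (n : nat) (g h : cube n -> R) T :
  fourier (fun x => g x - h x) T = fourier g T - fourier h T.
Proof.
rewrite /fourier /expectation -mulrBl -sumrB; congr (_ / _).
by apply: eq_bigr => x _; rewrite mulrBl.
Qed.

Lemma probE (R : realType) (n : nat) (P : pred (cube n)) :
  prob R P = expectation (fun x => (P x)%:R).
Proof.
congr (_ / _); rewrite -sum1_card natr_sum big_mkcond/=.
by apply: eq_bigr => x _; rewrite inE; case: (P x).
Qed.

Lemma eq_prob (R : realType) (n : nat) (P Q : pred (cube n)) :
  P =1 Q -> prob R P = prob R Q.
Proof. by move=> PQ; rewrite !probE; apply: eq_expectation => x; rewrite PQ. Qed.

(** The coordinates are independent, so the expectation factors; an odd power of a random sign has
    mean 0, an even one mean 1. *)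
Lemma expectation_monomial (R : realType) (n : nat) (e : 'I_n -> nat) :
  expectation (fun x : cube n => \prod_i spin R (x i) ^+ e i) =
  [forall i, ~~ odd (e i)]%:R.
Proof.
rewrite /expectation card_cube.
rewrite -(bigA_distr_bigA (fun i (b : bool) => spin R b ^+ e i)).
have E i : \sum_b spin R b ^+ e i = if odd (e i) then 0 else 2.
  rewrite big_bool /spin/= expr1 expr0 expr1n -signr_odd.
  by case: (odd _); rewrite ?expr1 ?expr0 ?addNr.
under eq_bigr do rewrite E.
case: forallP => [h|/forallP]; last first.
  rewrite negb_forall => /existsP[i]; rewrite negbK => oi.
  by rewrite (bigD1 i)//= oi !mul0r.
rewrite (eq_bigr (fun=> 2)) => [|i _]; last by rewrite (negPf (h i)).
by rewrite prodr_const card_ord natrX divff// expf_neq0 ?pnatr_eq0.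
Qed.

Lemma fourier_1 (R : realType) (n : nat) (T : {set 'I_n}) :
  fourier (fun=> 1 : R) T \is a Num.int.
Proof.
rewrite /fourier (eq_expectation (h := fun x => \prod_i spin R (x i) ^+ (i \in T))).
  by rewrite expectation_monomial rpred_nat.
by move=> x; rewrite mul1r chi_exp.
Qed.

(** The sum over [S] expands the product of the factors 1 + x_i y_i, one of which vanishes as soon
    as [x] and [y] differ. *)
Lemma sum_chi_chi (R : realType) (n : nat) (x y : cube n) :
  \sum_S chi R S x * chi R S y = if x == y then 2 ^+ n else 0.
Proof.
transitivity (\prod_i (spin R (x i) * spin R (y i) + 1)).
  rewrite bigA_distr; apply: eq_bigr => S _.
  by rewrite /chi -big_split/= big_mkcond.
case: eqP => [<-|/eqP xy].
  under eq_bigr do rewrite -spin_addb addbb.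
  by rewrite prodr_const card_ord.
have [i xyi] : exists i, x i != y i.
  apply/existsP; rewrite -negb_forall; apply: contra xy => /forallP h.
  by apply/eqP/ffunP => i; apply/eqP.
rewrite (bigD1 i)//= -spin_addb.
by move: xyi; rewrite -negb_eqb => /negPf; case: (x i) (y i) => -[]//= _;
  rewrite addNr mul0r.
Qed.

(** Summing over [S] first leaves only the diagonal terms x = y. *)
Lemma plancherel (R : realType) (n : nat) (g h : cube n -> R) :
  \sum_S fourier g S * fourier h S = expectation (fun x => g x * h x).
Proof.
have N0 : (2 : R) ^+ n != 0 by rewrite expf_neq0 ?pnatr_eq0.
rewrite /fourier /expectation card_cube natrX.
transitivity (\sum_x \sum_y g x * h y * (\sum_S chi R S x * chi R S y)
              / 2 ^+ n / 2 ^+ n).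
  under eq_bigr do rewrite mulrACA -invfM big_distrlr/= mulr_suml.
  rewrite exchange_big/=; apply: eq_bigr => x _.
  under eq_bigr do rewrite mulr_suml.
  rewrite exchange_big/=; apply: eq_bigr => y _.
  rewrite -mulrA -invfM mulr_sumr mulr_suml; apply: eq_bigr => S _.
  by rewrite mulrACA.
rewrite mulr_suml; apply: eq_bigr => x _.
rewrite (bigD1 x)//= [X in _ + X]big1 => [|y yx].
  by rewrite sum_chi_chi eqxx mulfK// addr0.
by rewrite sum_chi_chi eq_sym (negPf yx) mulr0 !mul0r.
Qed.

(** * Fourier coefficients and measure of affine subspaces *)

Lemma natr_forall (R : comPzRingType) (I : finType) (P : pred I) :
  [forall i, P i]%:R = \prod_i (P i)%:R :> R.
Proof.
case: forallP => [h|/forallP]; first by rewrite big1// => i _; rewrite h.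
rewrite negb_forall => /existsP[i /negPf Pi].
by rewrite (bigD1 i)//= Pi mul0r.
Qed.

(** The indicator of one equation is (1 + b_j chi_{S_j}) / 2. Expanding the product of [k] of these
    gives one monomial for each set [J] of equations. *)
Lemma affine_fourier (R : realType) (n k : nat) (S : 'I_k -> {set 'I_n})
    (b : 'I_k -> bool) (T : {set 'I_n}) :
  fourier (fun x => (x \in [set x : cube n |
      [forall j, chi int (S j) x == spin int (b j)]])%:R : R) T * 2 ^+ k =
  \sum_(J : {set 'I_k}) (\prod_(j in J) spin R (b j)) *
    [forall i, ~~ odd (\sum_(j in J) (i \in S j) + (i \in T))]%:R.
Proof.
have two (c d : bool) : (spin int c == spin int d)%:R * 2 = spin R d * spin R c + 1.
  by rewrite /spin; case: c d => -[]/=; rewrite ?(eqr_oppLR, expr0, expr1); ring.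
rewrite mulrC -fourierZ /fourier.
under [RHS]eq_bigr do rewrite -expectation_monomial -expectationZ.
rewrite -expectation_sum; apply: eq_expectation => x.
rewrite inE natr_forall.
have -> : 2 ^+ k * \prod_j (chi int (S j) x == spin int (b j))%:R =
    \prod_j (spin R (b j) * chi R (S j) x + 1).
  rewrite -[in 2 ^+ k](card_ord k) -prodr_const -big_split/=.
  by apply: eq_bigr => j _; rewrite !chi_parity mulrC two.
rewrite bigA_distr mulr_suml; apply: eq_bigr => J _.
rewrite -big_mkcond big_split/= -mulrA; congr (_ * _).
under [RHS]eq_bigr do rewrite exprD.
rewrite big_split/= -chi_exp; congr (_ * _).
under [RHS]eq_bigr do rewrite -prodrXr.
by rewrite exchange_big/=; apply: eq_bigr => j _; rewrite chi_exp.
Qed.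

(** Each term of the expansion is 0 or a sign. *)
Lemma affine_granular (R : realType) (n : nat) (C : {set cube n}) (k : nat) T :
  affine_subspace_of_codim C k ->
  fourier (fun x => (x \in C)%:R : R) T * 2 ^+ k \is a Num.int.
Proof.
move=> [S [b [_ ->]]]; rewrite affine_fourier rpred_sum// => J _.
by rewrite rpredM ?rpred_nat// rpred_prod// => j _; rewrite rpredX// rpredN rpred1.
Qed.

(** The probability is the Fourier coefficient at the empty set, and linear independence leaves only
    the term [J = set0] of its expansion. *)
Lemma affine_prob (R : realType) (n : nat) (C : {set cube n}) (k : nat) :
  affine_subspace_of_codim C k -> prob R (fun x => x \in C) = 2 ^- k.
Proof.
move=> [S [b [free ->]]].
have k0 : (2 : R) ^+ k != 0 by rewrite expf_neq0 ?pnatr_eq0.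
apply: (mulIf k0); rewrite mulVf// probE.
transitivity (fourier (fun x => (x \in [set x : cube n |
    [forall j, chi int (S j) x == spin int (b j)]])%:R : R) set0 * 2 ^+ k).
  by congr (_ * _); apply: eq_expectation => x; rewrite /chi big_set0 mulr1.
rewrite affine_fourier (bigD1 set0)//= [X in _ + X]big1 => [|J J0].
  rewrite big_set0 mul1r addr0; case: forallP => //= -[] i.
  by rewrite big_set0 inE.
case: forallP => [h|]; last by rewrite mulr0.
(* If every coordinate is covered an even number of times, the indicator row of [J] lies in the left
   kernel of a row-free matrix. *)
suff /eqP : \row_j (j \in J)%:R = 0 :> 'rV['F_2]_k.
  move=> /eqP/rowP u0; case/eqP: J0; apply/setP => j; rewrite inE.
  by have := u0 j; rewrite !mxE; case: (j \in J).
apply/eqP; rewrite -(mulmx_free_eq0 _ free); apply/eqP/rowP => i; rewrite !mxE.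
transitivity ((\sum_(j in J) (i \in S j))%:R : 'F_2).
  rewrite natr_sum [RHS]big_mkcond/=; apply: eq_bigr => j _; rewrite !mxE.
  by case: (j \in J); rewrite ?mul1r ?mul0r.
have := h i; rewrite inE addn0 => hi.
by apply/eqP; rewrite -(dvdn_pcharf (pchar_Fp (isT : prime 2))) dvdn2.
Qed.

(** * From partitions of the cube to entropy bounds *)

Lemma entropy_le_labels (R : realType) (n : nat) (f : cube n -> R) (I : finType)
    (h : cube n -> I) (k : I -> nat) :
  (forall x, f x ^+ 2 = 1) ->
  (forall i T, fourier (fun x => f x * (h x == i)%:R) T * 2 ^+ k i \is a Num.int) ->
  fourier_entropy f <= 2 * \sum_i prob R (fun x => h x == i) * (k i)%:R.
Proof.
move=> f2 gran; apply: (@entropy_le _ _ _ (fourier f)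
  (fun i => fourier (fun x => f x * (h x == i)%:R))).
have sum1 x : \sum_i (h x == i)%:R = 1 :> R.
  by rewrite (bigD1 (h x))//= eqxx big1 ?addr0// => i; rewrite eq_sym => /negPf->.
split=> //.
- move=> T; rewrite -fourier_sum; apply: eq_fourier => x.
  by rewrite -mulr_sumr sum1 mulr1.
- move=> i j; rewrite plancherel; case: eqP => [<-|/eqP ij].
    rewrite probE; apply: eq_expectation => x.
    by rewrite mulrACA -expr2 f2 mul1r; case: eqP => _; rewrite ?mulr1 ?mulr0.
  rewrite -(mul0r (expectation (fun x : cube n => 0 : R))) -expectationZ.
  apply: eq_expectation => x; rewrite mul0r.
  case: (h x =P i) => [->|]; last by rewrite mulr0 mul0r.
  by rewrite (negPf ij) !mulr0.
- under eq_bigr do rewrite probE.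
  rewrite -expectation_sum (eq_expectation sum1) /expectation sumr_const.
  by rewrite divff// card_cube pnatr_eq0 expn_eq0.
Qed.

Lemma sum_option (V : nmodType) (I : finType) (F : option I -> V) :
  \sum_o F o = F None + \sum_i F (Some i).
Proof.
rewrite (bigD1 None)//=; congr (_ + _).
rewrite (reindex_omap Some id) => [|[]//].
by apply: eq_bigl => i; rewrite eqxx.
Qed.

(* The whole level set [f x != s] serves as a single cell: its indicator is 1
   minus the indicators of the cells of [f x == s], hence is as granular as the
   finest of them. *)
Lemma entropy_le_one_sided (R : realType) (n : nat) (f : cube n -> R) (s : R)
    (I : finType) (Q : pred I) (C : I -> {set cube n}) (codim : I -> nat) :
  s \is a Num.int -> s ^+ 2 = 1 -> (forall x, f x = s \/ f x = - s) ->
  injective C ->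
  (forall i, affine_subspace_of_codim (C i) (codim i)) ->
  partition [set C i | i : I & Q i] [set x | f x == s] ->
  fourier_entropy f <=
    2 * (\sum_(i | Q i) (codim i)%:R * 2 ^- codim i
         + prob R (fun x => f x != s) * (\max_(i | Q i) codim i)%:R).
Proof.
move=> sint s2 fs Cinj aff /and3P[/eqP cov triv _].
have inC x : (f x == s) = [exists i, Q i && (x \in C i)].
  have -> : (f x == s) = (x \in [set x | f x == s]) by rewrite inE.
  rewrite -cov; apply/bigcupP/existsP => [[A /imsetP[i Qi ->] xi]|[i /andP[Qi xi]]].
    by exists i; rewrite xi andbT; rewrite inE in Qi.
  by exists (C i) => //; apply: imset_f; rewrite inE.
(* Injectivity of [C] turns disjointness of the cells into uniqueness of the index. *)
have Cuniq x i j : Q i -> Q j -> x \in C i -> x \in C j -> i = j.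
  move=> Qi Qj xi xj; apply: Cinj.
  have mC l : Q l -> C l \in [set C i | i : I & Q i].
    by move=> Ql; apply: imset_f; rewrite inE.
  by rewrite -(def_pblock triv (mC _ Qi) xi) -(def_pblock triv (mC _ Qj) xj).
(* The label is the index of the cell; [None] marks the opposite level set. *)
pose h x := [pick i | Q i && (x \in C i)].
have hSome x i : (h x == Some i) = Q i && (x \in C i).
  rewrite /h; case: pickP => [j /andP[Qj xj]|->]//.
  apply/eqP/andP => [[<-]//|[Qi xi]]; congr Some; exact: (Cuniq x).
have hNone x : (h x == None) = (f x != s).
  rewrite inC /h; case: pickP => [j Pj|P0].
    by symmetry; apply/negbTE; rewrite negbK; apply/existsP; exists j.
  by symmetry; apply/existsPn => i; rewrite P0.
pose k o := if o is Some i then codim i else \max_(i | Q i) codim i.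
have ind x : \sum_(i | Q i) (x \in C i)%:R = (f x == s)%:R :> R.
  rewrite inC; case: existsP => [[i /andP[Qi xi]]|N].
    rewrite (bigD1 i)//= xi big1 ?addr0// => j /andP[Qj ji].
    by case: (boolP (x \in C j)) => // xj; rewrite (Cuniq x j i) ?eqxx in ji.
  by rewrite big1// => i Qi; case: (boolP (x \in C i)) => // xi; case: N; exists i;
    rewrite Qi.
have f2 x : f x ^+ 2 = 1 by case: (fs x) => ->; rewrite ?sqrrN.
have gran o T : fourier (fun x => f x * (h x == o)%:R) T * 2 ^+ k o \is a Num.int.
  case: o => [i|] /=.
    (* An index outside [Q] is never a label, so its piece is zero. *)
    case: (boolP (Q i)) => Qi; last first.
      rewrite (eq_fourier (h := fun=> 0 * 1)) => [|x].
        by rewrite (fourierZ 0 (fun=> 1)) !mul0r rpred0.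
      by rewrite hSome (negPf Qi) mulr0 mul0r.
    rewrite (eq_fourier (h := fun x => s * (x \in C i)%:R)) => [|x].
      by rewrite fourierZ -mulrA rpredM// affine_granular.
    rewrite hSome Qi/=; case: (boolP (x \in C i)) => xi; last by rewrite !mulr0.
    congr (_ * _); apply/eqP; rewrite inC; apply/existsP; exists i.
    by rewrite Qi.
  (* On the opposite level set [f] equals [- s]; the maximal codimension clears the denominators of
     all cells at once. *)
  rewrite (eq_fourier (h := fun x => - s * (1 - \sum_(i | Q i) (x \in C i)%:R))).
    rewrite fourierZ fourierB fourier_sum -mulrA rpredM ?rpredN// mulrBl rpredB//.
      by rewrite rpredM ?fourier_1// rpredX// rpred_nat.
    rewrite mulr_suml rpred_sum// => i Qi.
    have ki : (codim i <= \max_(i | Q i) codim i)%N by exact: leq_bigmax_cond.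
    by rewrite -(subnKC ki) exprD mulrA rpredM ?affine_granular// rpredX// rpred_nat.
  move=> x; rewrite hNone ind; case: eqP => [_|fx].
    by rewrite subrr !mulr0.
  by rewrite subr0; case: (fs x) => [/fx[]|->].
apply: le_trans (entropy_le_labels f2 gran) _; rewrite ler_pM2l// sum_option/=.
rewrite addrC lerD//; last first.
  by rewrite (eq_prob _ hNone).
(* A label in [Q] has probability 2^-codim, any other index has probability 0. *)
rewrite [leRHS]big_mkcond/=; apply: ler_sum => i _; case: ifPn => Qi.
  rewrite mulrC -(affine_prob R (aff i)) (@eq_prob R n _ (fun x => x \in C i))// => x.
  by rewrite hSome Qi.
rewrite (@eq_prob R n _ xpred0) => [|x]; last by rewrite hSome (negPf Qi).
by rewrite /prob -sum1_card big_pred0 ?mul0r// => x; rewrite inE.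
Qed.

Theorem theorem1p7 (R : realType) (n : nat) (f : cube n -> R)
    (f_pm1 : forall x, f x = -1 \/ f x = 1)
    (t t1 : nat) (t1_ge1 : (1 <= t1)%N) (t1_lt_t : (t1 < t)%N)
    (C : 'I_t -> {set cube n}) (codim : 'I_t -> nat)
    (C_inj : injective C)
    (C_affine : forall i, affine_subspace_of_codim (C i) (codim i))
    (C_const : forall i x y, x \in C i -> y \in C i -> f x = f y)
    (C_part : partition [set C i | i : 'I_t] [set: cube n])
    (C_part_neg :
      partition [set C i | i : 'I_t & (i < t1)%N] [set x | f x == -1])
    (C_part_pos :
      partition [set C i | i : 'I_t & (t1 <= i)%N] [set x | f x == 1])
    (p : R) (p_def : p = prob R (fun x => f x == 1)) :
  fourier_entropy f <=
    2 * (\sum_(i < t | (i < t1)%N) (codim i)%:R * 2 ^- codim i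
         + p * (\max_(i < t | (i < t1)%N) codim i)%:R)
  /\
  fourier_entropy f <=
    2 * (\sum_(i < t | (t1 <= i)%N) (codim i)%:R * 2 ^- codim i
         + (1 - p) * (\max_(i < t | (t1 <= i)%N) codim i)%:R).
Proof.
have f2 x : f x = 1 \/ f x = -1 by case: (f_pm1 x); [right|left].
have fN1 x : (f x != -1) = (f x == 1).
  have e : (1 == -1 :> R) = false by rewrite -addr_eq0 -(natrD _ 1 1) pnatr_eq0.
  by case: (f2 x) => ->; rewrite eqxx ?e// eq_sym e.
split.
  (* Here [s = -1], and the cell kept whole is the event [f x = 1]. *)
  rewrite p_def -(eq_prob R fN1).
  apply: (@entropy_le_one_sided R n f (-1)) C_inj C_affine C_part_neg.
  - by rewrite rpredN rpred1.
  - by rewrite sqrrN expr1n.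
  - by move=> x; rewrite opprK.
(* For the second bound [s = 1], and the cell kept whole is the complementary event. *)
have -> : 1 - p = prob R (fun x => f x != 1).
  rewrite p_def !probE /expectation.
  have N0 : #|{: cube n}|%:R != 0 :> R by rewrite card_cube pnatr_eq0 expn_eq0.
  rewrite -[X in X - _](divff N0) -mulrBl; congr (_ / _).
  rewrite -sum1_card natr_sum -sumrB; apply: eq_bigr => x _.
  by case: (f x == 1); rewrite ?subrr ?subr0.
by apply: (@entropy_le_one_sided R n f 1) C_inj C_affine C_part_pos; rewrite ?expr1n.
Qed.
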